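(* Let $\mathcal{S}$ be a unipotent numerical monoid in $G$. Then the unique minimal (with respect to inclusion) generating set of the monoid $\mathcal{S}$ is $\mathcal{S}^*\setminus(\mathcal{S}^*\mathcal{S}^* )$.
   Context: Setting: $n$ is a positive integer, $\mathbf{U}(n,\mathbb{C})$ is the group of upper triangular unipotent $n\times n$ complex matrices, and $G$ is a (Zariski) closed subgroup of it. $G_{\mathbb{Z}}$ is the group of matrices in $G$ with integer entries, and $G(\mathbb{N})$ is the monoid of matrices in $G_{\mathbb{Z}}$ all of whose entries lie in $\mathbb{N}=\{0,1,2,\dots\}$. Standing assumptions: the monoid $G(\mathbb{N})$ is finitely generated and $G_{\mathbb{Z}}$ is its group completion. $\mathbf{1}_n$ is the identity matrix. A unipotent numerical monoid in $G$ is a finitely generated submonoid $\mathcal{S}\subseteq G(\mathbb{N})$ (containing $\mathbf{1}_n$) such that $G(\mathbb{N})\setminus\mathcal{S}$ is finite; $\mathcal{S}^*:=\mathcal{S}\setminus\{\mathbf{1}_n\}$ and $\mathcal{S}^*\mathcal{S}^*:=\{AB\mid A,B\in\mathcal{S}^*\}$. A subset is a generating set for $\mathcal{S}$ if every element of $\mathcal{S}$ is a finite (possibly empty) product of elements of the subset. *)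

(* Defs.v *)
From HB Require Import structures.
From mathcomp Require Import all_boot all_order all_algebra.
From mathcomp Require Import boolp classical_sets functions cardinality reals.
From mathcomp Require Import complex mpoly.

Set Implicit Arguments.
Unset Strict Implicit.
Unset Printing Implicit Defensive.
Import GRing.Theory Num.Theory.

Local Open Scope classical_set_scope.
Local Open Scope complex_scope.
Local Open Scope ring_scope.

Section MatrixMonoids.
Variables (C : comUnitRingType) (n : nat).
Implicit Types (G N K S T : set 'M[C]_n) (A B : 'M[C]_n).

Definition upper_unipotent : set 'M[C]_n :=
  [set A | (forall i j : 'I_n, (j < i)%N -> A i j = 0) /\
           (forall i : 'I_n, A i i = 1)].

Definition mx_submonoid S : Prop :=
  S 1 /\ forall A B, S A -> S B -> S (A * B).

Definition mx_subgroup G : Prop :=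
  [/\ mx_submonoid G, G `<=` unitmx & forall A, G A -> G (invmx A)].

(* The noncommutative product \prod_(B <- s) B is taken in list order, and is
   the identity matrix when s is empty. *)
Definition generates S T : Prop :=
  T `<=` S /\
  forall A, S A ->
    exists2 s : seq 'M[C]_n, (forall B, B \in s -> T B) & A = \prod_(B <- s) B.

Definition finitely_generated S : Prop :=
  exists2 T, finite_set T & generates S T.

Definition minimal_generating_set S T : Prop :=
  generates S T /\ forall T', generates S T' -> T' `<=` T -> T' = T.

Definition nonid S : set 'M[C]_n := S `\ 1.

Definition mx_set_mul S T : set 'M[C]_n := [set A * B | A in S & B in T].

(* Homomorphisms out of a submonoid N are represented by functions on all
   matrices, of which only the values on N matter. *)
Definition mx_morphism N (H : groupType) (f : 'M[C]_n -> H) : Prop :=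
  f 1 = 1%g /\ forall A B, N A -> N B -> f (A * B) = (f A * f B)%g.

(* The group K, with the inclusion of N into K, satisfies the universal
   property of the group completion of the monoid N. *)
Definition is_group_completion N K : Prop :=
  [/\ mx_submonoid N, mx_subgroup K, N `<=` K &
  forall (H : groupType) (f : 'M[C]_n -> H), mx_morphism N f ->
    exists g : 'M[C]_n -> H,
      [/\ mx_morphism K g, forall A, N A -> g A = f A &
      forall g' : 'M[C]_n -> H, mx_morphism K g' ->
        (forall A, N A -> g' A = f A) -> forall A, K A -> g' A = g A]].

End MatrixMonoids.

Arguments upper_unipotent C n : clear implicits.

Section ComplexGroups.
Variables (R : realType) (n : nat).
Implicit Types (G S : set 'M[R[i]]_n).

(* Polynomials in the n * n entries of a matrix, enumerated by mxvec. *)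
Definition zariski_closed (X : set 'M[R[i]]_n) : Prop :=
  exists I : set {mpoly R[i][n * n]},
    X = [set A | forall p, I p -> p.@[mxvec A ord0] = 0].

Definition closed_unipotent_group G : Prop :=
  [/\ mx_subgroup G, G `<=` upper_unipotent R[i] n & zariski_closed G].

Definition integer_points G : set 'M[R[i]]_n :=
  G `&` [set A | forall i j, exists z : int, A i j = z%:~R].

Definition natural_points G : set 'M[R[i]]_n :=
  integer_points G `&` [set A | forall i j, exists k : nat, A i j = k%:R].

Definition unipotent_numerical_monoid G S : Prop :=
  [/\ mx_submonoid S, finitely_generated S, S `<=` natural_points G &
      finite_set (natural_points G `\` S)].

End ComplexGroups.

(* Main.v *)
(* The sum of the entries above the diagonal is a superadditive N-valued
   function on the unipotent matrices with natural entries, and it vanishes only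
   at the identity. By induction on it, each element of S is a product of
   elements of M = S* \ S*S*. Conversely no element of M is a product of two
   nontrivial elements of S, so every generating set contains M. *)
Require Import Defs.
From mathcomp Require Import all_boot all_order all_algebra.
From mathcomp Require Import boolp classical_sets functions cardinality reals.
From mathcomp Require Import complex mpoly.

Local Open Scope classical_set_scope.
Local Open Scope complex_scope.
Local Open Scope ring_scope.

Import Order.TTheory GRing.Theory Num.Theory.

Definition irreducibles {C : comUnitRingType} {n : nat} (S : set 'M[C]_n) :=
  nonid S `\` mx_set_mul (nonid S) (nonid S).

Lemma mx_submonoid_prod (C : comUnitRingType) (n : nat) (S : set 'M[C]_n)
    (s : seq 'M[C]_n) :
  mx_submonoid S -> (forall B, B \in s -> S B) -> S (\prod_(B <- s) B).
Proof.
move=> [S1 SM] sS; rewrite big_seq.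
exact: (big_ind (fun A => S A) S1 SM sS).
Qed.

(** Write an irreducible as a product of generators: two nontrivial factors would contradict
    irreducibility, so it equals one of the generators listed. *)
Lemma irreducibles_sub_generators (C : comUnitRingType) (n : nat)
    (S T : set 'M[C]_n) :
  mx_submonoid S -> generates S T -> irreducibles S `<=` T.
Proof.
move=> Smon [TS Tgen] A irrA.
have [s sT] := Tgen A irrA.1.1.
elim: s sT => [|B s IHs] sT; first by rewrite big_nil => A1; case: irrA.1.2.
have BT : T B by apply: sT; rewrite mem_head.
have sT' D : D \in s -> T D by move=> Ds; apply: sT; rewrite in_cons Ds orbT.
rewrite big_cons => defA.
(* [T] may contain the identity. A trivial head is dropped by induction; a trivial tail gives
   [A = B]. *)
have [B1|B1] := eqVneq B 1; first by apply: IHs => //; rewrite defA B1 mul1r.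
have [P1|P1] := eqVneq (\prod_(D <- s) D) 1; first by rewrite defA P1 mulr1.
case: irrA.2; exists B; first by split; [exact: TS|exact/eqP].
exists (\prod_(D <- s) D) => //.
split; last exact/eqP.
by apply: mx_submonoid_prod => // D /sT'; exact: TS.
Qed.

(** [w] acts as a length: in a product of two nontrivial elements each factor weighs strictly less
    than the product, since the other has positive weight. Hence repeated splitting terminates. *)
Lemma irreducibles_generate (C : comUnitRingType) (n : nat) (S : set 'M[C]_n)
    (w : 'M[C]_n -> nat) :
  (forall A B, S A -> S B -> (w A + w B <= w (A * B)%R)%N) ->
  (forall A, S A -> w A = 0%N -> A = 1) ->
  generates S (irreducibles S).
Proof.
move=> wM w0; split=> [A [[]] //|A].
have [k] := ubnP (w A); elim: k => // k IHk in A *.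
rewrite ltnS => wAk SA.
have [->|A1] := eqVneq A 1; first by exists [::] => //; rewrite big_nil.
have [[B [SB B1] [D [SD D1] defA]]|irrA] :=
  pselect (mx_set_mul (nonid S) (nonid S) A); last first.
  exists [:: A]; last by rewrite big_seq1.
  by move=> B; rewrite inE => /eqP ->; split=> //; split=> //; exact/eqP.
have wpos E : S E -> E <> 1 -> (0 < w E)%N.
  by move=> SE E1; rewrite lt0n; apply/eqP => /(w0 _ SE).
have wBD := wM B D SB SD; rewrite defA in wBD.
have [|s sI defB] := IHk B _ SB.
  apply: leq_trans wAk; apply: leq_trans wBD.
  by rewrite -[X in (X < _)%N]addn0 ltn_add2l; exact: wpos.
have [|t tI defD] := IHk D _ SD.
  apply: leq_trans wAk; apply: leq_trans wBD.
  by rewrite -[X in (X < _)%N]add0n ltn_add2r; exact: wpos.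
exists (s ++ t); last by rewrite big_cat /= -defB -defD defA.
by move=> E; rewrite mem_cat => /orP[/sI|/tI].
Qed.

Lemma irreducibles_unique_minimal (C : comUnitRingType) (n : nat)
    (S : set 'M[C]_n) :
  mx_submonoid S -> generates S (irreducibles S) ->
  unique (minimal_generating_set S) (irreducibles S).
Proof.
move=> Smon genI; split=> [|T [genT minT]].
  split=> // T genT TI; apply/seteqP; split=> //.
  exact: irreducibles_sub_generators.
(* The irreducibles form a generating set inside [T], so minimality of [T] forces equality. *)
by apply: minT => //; exact: irreducibles_sub_generators.
Qed.

Definition strict_upper_sum {C : comUnitRingType} {n : nat} (A : 'M[C]_n) : C :=
  \sum_(p : 'I_n * 'I_n | (p.1 < p.2)%N) A p.1 p.2.

(** Nonnegative terms with zero sum vanish one by one; unipotence fixes the remaining entries. *)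
Lemma strict_upper_sum_eq0 (C : numFieldType) (n : nat) (A : 'M[C]_n) :
  upper_unipotent C n A -> (forall i j, 0 <= A i j) ->
  strict_upper_sum A = 0 -> A = 1.
Proof.
move=> [Alow Adiag] A0 /eqP.
rewrite psumr_eq0 // => /allP Aup.
apply/matrixP => i j; rewrite mxE.
case: (ltngtP i j) => [ij|ji|/val_inj ->]; last by rewrite Adiag eqxx.
- have := Aup (i, j) (mem_index_enum _); rewrite /= ij /= => /eqP ->.
  by rewrite -val_eqE ltn_eqF.
- by rewrite Alow // -val_eqE gtn_eqF.
Qed.

Lemma strict_upper_sumM (C : numFieldType) (n : nat) (A B : 'M[C]_n) :
  upper_unipotent C n A -> upper_unipotent C n B ->
  (forall i j, 0 <= A i j) -> (forall i j, 0 <= B i j) ->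
  strict_upper_sum A + strict_upper_sum B <= strict_upper_sum (A * B).
Proof.
move=> [_ A1] [_ B1] A0 B0; rewrite -big_split /=.
apply: ler_sum => -[i j] /= ij; rewrite mxE.
(* In the sum over [k] of [A i k * B k j], the unit diagonals turn the terms [k = i] and [k = j],
   distinct as [i < j], into [B i j] and [A i j]. The other terms are nonnegative. *)
rewrite (bigD1 i) //= (bigD1 j) /=; last by rewrite -val_eqE gtn_eqF.
rewrite A1 B1 mul1r mulr1 addrCA addrA lerDl.
by apply: sumr_ge0 => k _; rewrite mulr_ge0.
Qed.

Lemma strict_upper_sum_natural (C : comUnitRingType) (n : nat) (A : 'M[C]_n) :
  (forall i j, exists k : nat, A i j = k%:R) ->
  exists k : nat, strict_upper_sum A = k%:R.
Proof.
move=> Anat; apply: (big_ind (fun x : C => exists k : nat, x = k%:R)) => //.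
- by exists 0%N.
- by move=> _ _ [k ->] [l ->]; exists (k + l)%N; rewrite natrD.
Qed.

Theorem theorem3p3 (R : realType) (n : nat) (hn : (0 < n)%N)
    (G S : set 'M[R[i]]_n)
    (hG : closed_unipotent_group G)
    (hfg : finitely_generated (natural_points G))
    (hcompl : is_group_completion (natural_points G) (integer_points G))
    (hS : unipotent_numerical_monoid G S) :
  unique (minimal_generating_set S)
    (nonid S `\` mx_set_mul (nonid S) (nonid S)).
Proof.
have [_ GU _] := hG; have [Smon _ SN _] := hS.
have SU A : S A -> upper_unipotent R[i] n A by move=> /SN[[/GU]].
have Snat A : S A -> forall i j, exists k : nat, A i j = k%:R.
  by move=> /SN[].
have S0 A : S A -> forall i j, 0 <= A i j.
  by move=> SA i j; have [k ->] := Snat A SA i j; exact: ler0n.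
(* The induction needs a weight in [nat], while the sum lies in [R[i]]; outside [S] the value 0 is a
   dummy. *)
have /choice[w wE] A : exists k : nat, S A -> strict_upper_sum A = k%:R.
  have [SA|nSA] := pselect (S A); last by exists 0%N.
  by have [k kE] := strict_upper_sum_natural _ _ _ (Snat A SA); exists k.
apply: irreducibles_unique_minimal => //.
apply: (irreducibles_generate _ _ _ w) => [A B SA SB|A SA wA0].
  have SAB : S (A * B) := Smon.2 A B SA SB.
  (* The inequality in [nat] is checked after embedding into [R[i]]. *)
  rewrite -(ler_nat R[i]) natrD -!wE //.
  by apply: strict_upper_sumM; auto.
by apply: strict_upper_sum_eq0; auto; rewrite wE // wA0.
Qed.
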